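(* The language $Q_I$ is dense over $V$: for every $w \in V^*$ there exist $x, y \in V^*$ such that $x w y \in Q_I$.
   Context: $V$ is a finite alphabet with at least two distinct letters; $V^*$ is the set of all finite words over $V$ (including the empty word). A nonempty word $w$ is primitive if it is not of the form $v^n$ for a word $v$ and an integer $n \ge 2$. For a word $w$ of length $n$, $w[1..i]$ denotes its prefix of length $i$ and $w[i+1..n]$ its suffix of length $n-i$. A primitive word $w$ of length $n$ is ins-robust if for every $i \in \{0,\ldots,n\}$ and every $a \in V$ the word $w[1..i]\,a\,w[i+1..n]$ is primitive; $Q_I$ is the set of ins-robust primitive words over $V$. *)

(* Defs.v *)
From mathcomp Require Import all_boot.
Set Implicit Arguments.
Unset Strict Implicit.
Unset Printing Implicit Defensive.

Section Words.
Variable V : Type.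
Implicit Types (v w : seq V) (L : seq V -> Prop).

Definition wpow v (n : nat) : seq V := flatten (nseq n v).

Definition primitive w : Prop :=
  w <> [::] /\ ~ exists v n, 2 <= n /\ w = wpow v n.

Definition insert w (i : nat) (a : V) : seq V := take i w ++ a :: drop i w.

(* The language Q_I. *)
Definition ins_robust w : Prop :=
  primitive w /\ forall i a, i <= size w -> primitive (insert w i a).

Definition dense L : Prop := forall w, exists x y, L (x ++ w ++ y).

End Words.

(* Main.v *)
(** If the numbers of occurrences of two letters in a word are coprime, then the
    word is primitive, since the exponent of a power divides both. Pad [w] on
    the right so that [b] occurs [m] times and [a] occurs [k] times, with [m]
    odd and [k = 1] modulo [m * (m + 1)]: the pairs [(k, m)], [(k + 1, m)] and
    [(k, m + 1)] are then all coprime, and these are the only pairs of counts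
    that inserting one letter can produce. *)
Require Import Defs.
From mathcomp Require Import all_boot.

Lemma count_wpow (V : eqType) (P : pred V) (v : seq V) (n : nat) :
  count P (wpow v n) = n * count P v.
Proof.
by rewrite /wpow; elim: n => //= n IHn; rewrite count_cat IHn mulSn.
Qed.

Lemma count_insert (V : eqType) (P : pred V) (w : seq V) (i : nat) (c : V) :
  count P (insert w i c) = P c + count P w.
Proof.
by rewrite -[in RHS](cat_take_drop i w) /insert !count_cat /= addnCA.
Qed.

Lemma coprime_counts_primitive (V : eqType) (P Q : pred V) (w : seq V) :
  coprime (count P w) (count Q w) -> primitive w.
Proof.
(* The empty word is excluded because [coprime 0 0] is false. *)
move=> co; split=> [w0|[v [n [n_ge2 wE]]]]; first by rewrite w0 in co.
have : n %| gcdn (count P w) (count Q w).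
  by rewrite wE !count_wpow dvdn_gcd !dvdn_mulr.
by rewrite (eqP co) dvdn1 => /eqP n1; rewrite n1 in n_ge2.
Qed.

Lemma coprime_counts_ins_robust (V : eqType) (a b : V) (w : seq V) :
    a != b ->
    let k := count_mem a w in let m := count_mem b w in
    coprime k m -> coprime k.+1 m -> coprime k m.+1 ->
  ins_robust w.
Proof.
move=> ab k m co co_a co_b; split=> [|i c _].
  exact: coprime_counts_primitive co.
apply: (@coprime_counts_primitive _ (pred1 a) (pred1 b)).
rewrite !count_insert /= -/k -/m.
(* A letter [c] other than [a] and [b] leaves both counts unchanged. *)
have [->|_] := eqVneq c a; first by rewrite (negbTE ab).
by have [_|_] := eqVneq c b.
Qed.

(** [k] is congruent to 1 modulo [m] and [m.+1], while [k.+1] is congruent to 2 modulo [m], hence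
    the oddness of [m]. *)
Lemma coprime_mulSnS (q m : nat) :
    odd m -> let k := (m * m.+1 * q).+1 in
  [/\ coprime k m, coprime k.+1 m & coprime k m.+1].
Proof.
move=> m_odd k; split; rewrite coprime_sym /k.
- by rewrite -mulnA mulnC -addn1 /coprime gcdnMDl gcdn1.
- by rewrite -mulnA mulnC -addn2 /coprime gcdnMDl -/(coprime m 2) coprimen2.
- by rewrite mulnAC -[X in coprime _ X]addn1 /coprime gcdnMDl gcdn1.
Qed.

Theorem theorem17 (V : finType) (hV : 2 <= #|V|) : dense (@ins_robust V).
Proof.
move=> w; have /card_gt1P [a [b [_ _ ab]]] := hV.
(* These choices also bound the counts of [b] and [a] in [w], so that padding can raise them to
   exactly [m] and [k]. *)
pose m := (count_mem b w).*2.+1.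
pose k := (m * m.+1 * count_mem a w).+1.
have le_bm : count_mem b w <= m by rewrite /m -addnn leqW // leq_addr.
have le_ak : count_mem a w <= k by rewrite /k leqW // leq_pmull.
exists [::], (nseq (m - count_mem b w) b ++ nseq (k - count_mem a w) a).
have m_odd : odd m by rewrite /m /= odd_double.
have [co co_a co_b] := @coprime_mulSnS (count_mem a w) m m_odd.
have ba : (b == a) = false by rewrite eq_sym (negbTE ab).
apply: (@coprime_counts_ins_robust _ a b) => //=;
  rewrite !count_cat !count_nseq /= !eqxx (negbTE ab) ba !mul0n !mul1n
          ?add0n ?addn0 !subnKC //.
Qed.
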